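(* Let $M$ be a metric space with a fixed point $0$, and let $(u_i)_{i\in\mathbb{N}}$ be a sequence of pairwise distinct points in $M$ such that for all $i\in\mathbb{N}$, $\delta>0$, and $v\in M\setminus\{u_i\}$ there exists $p\in[u_i,v]_\delta\setminus\{u_i\}$ with $$\inf_{j\in\mathbb{N}}d(u_j,p)>(1-\delta)d(u_i,p).$$ Then there exists a Daugavet-point $f\in S_{\mathrm{Lip}_0(M)}$.
   Context: For $u,v\in M$ and $\delta>0$, $[u,v]_\delta=\{p\in M: d(u,p)+d(v,p)<d(u,v)+\delta\}$. For a metric space $(M,d)$ with a fixed point $0\in M$, $\mathrm{Lip}_0(M)$ is the real Banach space of all Lipschitz functions $f:M\to\mathbb{R}$ with $f(0)=0$, normed by the Lipschitz constant. For a real Banach space $X$ with closed unit ball $B_X$ and unit sphere $S_X$, a point $x\in S_X$ is a Daugavet-point if $B_X=\overline{\mathrm{conv}}\{y\in B_X:\|x-y\|\ge2-\varepsilon\}$ for every $\varepsilon>0$. *)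

(* Defs.v *)
From HB Require Import structures.
From mathcomp Require Import all_boot all_order all_algebra.
From mathcomp Require Import all_classical all_reals all_analysis.

Set Implicit Arguments.
Unset Strict Implicit.
Unset Printing Implicit Defensive.

Import Order.TTheory GRing.Theory Num.Theory.
Import numFieldNormedType.Exports.

Local Open Scope classical_set_scope.
Local Open Scope ring_scope.

Section LipschitzConstant.
Context {R : realType} {M : metricType R}.
Implicit Types (f : M -> R) (x y : M) (k : R).

(* The library's [k.-lipschitz f] is only available when the domain is a
   normed module. *)
Definition lipschitz_with k f : Prop :=
  forall x y, `|f x - f y| <= k * mdist x y.

(* [sup set0] is 0, so the constant is 0 when M is a single point. *)
Definition lipschitz_const f : R :=
  sup [set `|f xy.1 - f xy.2| / mdist xy.1 xy.2 |
       xy in [set xy : M * M | xy.1 != xy.2]].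

Lemma lipschitz_const_le k f :
  0 <= k -> lipschitz_with k f -> lipschitz_const f <= k.
Proof.
move=> k0 fk; rewrite /lipschitz_const; set S := [set _ | _ in _].
have [->|S0] := eqVneq S set0; first by rewrite sup0.
apply: ge_sup; first exact/set0P.
by move=> _ [[x y] /= xy <-]; rewrite ler_pdivrMr ?mdist_gt0.
Qed.

Lemma lipschitz_with_const k f :
  lipschitz_with k f -> lipschitz_with (lipschitz_const f) f.
Proof.
move=> fk x y; have [->|xy] := eqVneq x y.
  by rewrite subrr normr0 mdistxx mulr0.
rewrite -ler_pdivrMr ?mdist_gt0//; apply: ub_le_sup; last by exists (x, y).
exists k => _ [[a b] /= ab <-].
by rewrite ler_pdivrMr ?mdist_gt0.
Qed.

Lemma lipschitz_const_ge0 f : 0 <= lipschitz_const f.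
Proof.
rewrite /lipschitz_const; set S := [set _ | _ in _].
have [[[z Sz] Sub]|Sno] := pselect (has_sup S); last first.
  by rewrite sup_out.
apply: le_trans (ub_le_sup Sub Sz); case: Sz => xy _ <-.
by rewrite divr_ge0// mdist_ge0.
Qed.

End LipschitzConstant.

Section Lip0Pred.
Context {R : realType} {M : metricType R} (o : M).

Definition lip0_pred : {pred M -> R} :=
  mem [set f | f o = 0 /\ exists k, lipschitz_with k f].

Lemma lip0_predP (f : M -> R) :
  reflect (f o = 0 /\ lipschitz_with (lipschitz_const f) f) (f \in lip0_pred).
Proof.
apply: (iffP idP) => [/[!inE] -[f0 [k /lipschitz_with_const]]//|[f0 fk]].
by rewrite inE; split=> //; exists (lipschitz_const f).
Qed.

Lemma lip0_submod_closed : submod_closed lip0_pred.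
Proof.
split=> [|a f g /lip0_predP[f0 fk] /lip0_predP[g0 gk]].
  by rewrite inE; split=> //; exists 0 => x y; rewrite subrr normr0 mul0r.
rewrite inE; split; first by rewrite /= !fctE f0 g0 scaler0 addr0.
exists (`|a| * lipschitz_const f + lipschitz_const g) => x y.
rewrite !fctE opprD addrACA -scalerBr mulrDl.
by rewrite (le_trans (ler_normD _ _))// lerD// normrZ -mulrA ler_wpM2l.
Qed.

HB.instance Definition _ :=
  GRing.isSubmodClosed.Build _ _ lip0_pred lip0_submod_closed.

End Lip0Pred.

Record lip0 (R : realType) (M : metricType R) (o : M) := Lip0 {
  lip0_fun :> M -> R;
  lip0_funP : lip0_fun \in lip0_pred o
}.

Section Lip0Space.
Context {R : realType} {M : metricType R} {o : M}.
Implicit Types (f g : lip0 o).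

HB.instance Definition _ := [isSub for @lip0_fun R M o].
HB.instance Definition _ := [Choice of lip0 o by <:].
HB.instance Definition _ := [SubChoice_isSubLmodule of lip0 o by <:].

Lemma lip0_lipschitz f : lipschitz_with (lipschitz_const f) f.
Proof. by have /lip0_predP[] := lip0_funP f. Qed.

Lemma lip0_base f : f o = 0.
Proof. by have /lip0_predP[] := lip0_funP f. Qed.

Let nm f : R := lipschitz_const f.

Let nmD f g : nm (f + g) <= nm f + nm g.
Proof.
apply: lipschitz_const_le => [|x y].
  by rewrite addr_ge0// lipschitz_const_ge0.
rewrite /= opprD addrACA mulrDl (le_trans (ler_normD _ _))//.
by rewrite lerD// lip0_lipschitz.
Qed.

Let nmZ_le a f : nm (a *: f) <= `|a| * nm f.
Proof.
apply: lipschitz_const_le => [|x y].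
  by rewrite mulr_ge0// lipschitz_const_ge0.
by rewrite /= -scalerBr normrZ -mulrA ler_wpM2l// lip0_lipschitz.
Qed.

Let nmZ a f : nm (a *: f) = `|a| * nm f.
Proof.
apply/eqP; rewrite eq_le nmZ_le/=.
have [->|a0] := eqVneq a 0; first by rewrite normr0 mul0r lipschitz_const_ge0.
rewrite -ler_pdivlMl ?normr_gt0// -normfV.
by rewrite -[X in nm X <= _](scalerK a0) nmZ_le.
Qed.

Let nm0_eq0 f : nm f = 0 -> f = 0.
Proof.
move=> f0; apply/val_inj/funext => x /=.
have := lip0_lipschitz f x o; rewrite -/(nm f) f0 mul0r lip0_base subr0.
by rewrite normr_le0 => /eqP.
Qed.

HB.instance Definition _ :=
  Lmodule_isNormed.Build R (lip0 o) nmD nmZ nm0_eq0.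

Lemma lip0_normE f : `|f| = lipschitz_const f.
Proof. by []. Qed.

Lemma lip0_ler f x y : `|f x - f y| <= `|f| * mdist x y.
Proof. exact: lip0_lipschitz. Qed.

Lemma lip0_norm_le k f : 0 <= k -> lipschitz_with k f -> `|f| <= k.
Proof. exact: lipschitz_const_le. Qed.

Lemma lip0_complete (F : set_system (lip0 o)) :
  ProperFilter F -> cauchy F -> cvg F.
Proof.
move=> FF /cauchyP Fc.
have near_dist e : 0 < e -> exists f, \forall g \near F, `|f - g| <= e.
  move=> e0; have [f Ff] := Fc _ e0; exists f; apply: filterS Ff => g.
  by rewrite -ball_normE => /ltW.
have cvgF x : cvg ((fun f : lip0 o => f x) @ F).
  apply: cauchy_cvg; apply/cauchyP => e e0.
  have d0 : 0 < mdist x o + 1 by rewrite ltr_wpDl// mdist_ge0.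
  have [f Ff] := near_dist _ (divr_gt0 e0 d0); exists (f x).
  apply: filterS Ff => g fg; rewrite -ball_normE/=.
  have := lip0_ler (f - g) x o; rewrite /= !fctE !lip0_base subrr subr0.
  move=> /le_lt_trans; apply.
  rewrite (@le_lt_trans _ _ (e / (mdist x o + 1) * mdist x o))//.
    by rewrite ler_wpM2r// mdist_ge0.
  by rewrite mulrAC ltr_pdivrMr// ltr_pM2l// ltrDl.
pose h x : R := lim ((fun f : lip0 o => f x) @ F).
have dist_le f e : (\forall g \near F, `|f - g| <= e) ->
    lipschitz_with e (fun x => f x - h x).
  move=> Ff x y.
  have : (fun g : lip0 o => `|f x - g x - (f y - g y)|) @ F -->
      `|f x - h x - (f y - h y)|.
    apply: cvg_norm; apply: cvgB; apply: cvgB; [exact: cvg_cst|exact: cvgF|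
      exact: cvg_cst|exact: cvgF].
  move=> /cvgr_to_le; apply; apply: filterS Ff => g fg.
  by rewrite (le_trans (lip0_ler (f - g) x y))// ler_wpM2r// mdist_ge0.
have hP : h \in lip0_pred o.
  rewrite inE; split.
    rewrite /h; apply: cvg_lim => //.
    under eq_fun do rewrite lip0_base; exact: cvg_cst.
  have [f /dist_le fh] := near_dist _ ltr01.
  exists (`|f| + 1) => x y.
  have -> : h x - h y = (f x - f y) - (f x - h x - (f y - h y)).
    rewrite -[LHS](subKr (f x - f y)); congr (_ - _).
    by rewrite !opprD [RHS]addrACA.
  by rewrite mulrDl (le_trans (ler_normB _ _))// lerD ?lip0_ler.
apply/cvg_ex; exists (Lip0 hP); apply/cvgrPdist_le => e e0.
have e20 : 0 < e / 2 by rewrite divr_gt0.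
have [f Ff] := near_dist _ e20; apply: filterS (Ff) => g fg.
rewrite -(subrKA f) (splitr e) (le_trans (ler_normD _ _))// lerD//.
rewrite distrC; apply: lip0_norm_le; first exact: ltW.
exact: dist_le.
Qed.

HB.instance Definition _ :=
  Uniform_isComplete.Build (lip0 o) lip0_complete.

End Lip0Space.

Section Daugavet.
Context {R : realType} {X : completeNormedModType R}.

Definition convex_hull (A : set X) : set X := smallest (@convex_set R X) A.

Definition daugavet_point (x : X) : Prop :=
  `|x| = 1 /\
  forall e : R, 0 < e ->
    [set y : X | `|y| <= 1] =
    closure (convex_hull [set y : X | `|y| <= 1 /\ 2 - e <= `|x - y|]).

End Daugavet.

Definition metric_segment (R : realType) (M : metricType R) (u v : M)
    (delta : R) : set M :=
  [set p | mdist u p + mdist v p < mdist u v + delta].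

(* Main.v *)
(* Take f = D - D(o), where D is the distance to the set {u_j}.  Near each u_i
   the hypothesis provides p with (f p - f (u_i)) / d(u_i, p) close to 1, while
   any g in the unit ball can be raised, in an arbitrarily small neighbourhood
   of u_i, to h_i in the unit ball with (h_i p - h_i (u_i)) / d(u_i, p) close to
   -1, so that |f - h_i| is almost 2.  The functions h_i - g for finitely many i
   are nonnegative with disjoint supports, so their sum is still 2-Lipschitz and
   the average of n of the h_i is within 2/n of g. *)
Require Import Defs.
From HB Require Import structures.
From mathcomp Require Import all_boot all_order all_algebra.
From mathcomp Require Import all_classical all_reals all_analysis.
From mathcomp Require Import ring lra.

Set Implicit Arguments.
Unset Strict Implicit.
Unset Printing Implicit Defensive.

Import Order.TTheory GRing.Theory Num.Theory.
Import numFieldNormedType.Exports.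

Local Open Scope classical_set_scope.
Local Open Scope ring_scope.

(** * Lipschitz functions, maxima with cones and disjoint sums *)

Section LipschitzFunctions.
Context {R : realType} {M : metricType R}.
Implicit Types (f g h : M -> R) (x y z a p v : M).

Lemma lipschitz_with_sub k f :
  (forall x y, f x - f y <= k * mdist x y) -> lipschitz_with k f.
Proof.
move=> fk x y; rewrite ler_norml lerNl opprB fk andbT.
by rewrite [mdist x y]metric_sym fk.
Qed.

Lemma lipschitz_with_subr k f x y :
  lipschitz_with k f -> f x - f y <= k * mdist x y.
Proof. by move=> fk; apply: le_trans (fk x y); exact: ler_norm. Qed.

Lemma lipschitz_with_le k k' f :
  k <= k' -> lipschitz_with k f -> lipschitz_with k' f.
Proof.
by move=> kk' fk x y; rewrite (le_trans (fk x y))// ler_wpM2r// mdist_ge0.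
Qed.

Lemma lipschitz_withB k k' f g :
  lipschitz_with k f -> lipschitz_with k' g ->
  lipschitz_with (k + k') (fun x => f x - g x).
Proof.
move=> fk gk x y.
have -> : f x - g x - (f y - g y) = f x - f y - (g x - g y) by ring.
by rewrite mulrDl (le_trans (ler_normB _ _))// lerD.
Qed.

Lemma lipschitz_with_max_cone f a t :
  lipschitz_with 1 f ->
  lipschitz_with 1 (fun x => Num.max (f x) (t - mdist x a)).
Proof.
move=> f1; apply: lipschitz_with_sub => x y; rewrite mul1r lerBlDr ge_max.
set m := Num.max _ _.
have m1 : f y <= m by rewrite le_max lexx.
have m2 : t - mdist y a <= m by rewrite le_max lexx orbT.
have := lipschitz_with_subr x y f1; have := metric_triangle y x a.
by rewrite mul1r [mdist y x]metric_sym => tri fxy; apply/andP; split; lra.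
Qed.

(** The constant does not double: at [x] at most one term [b i x] survives, and at [y] nonnegativity
    gives [b i y <=] the whole sum, so the one-sided difference is at most [b i x - b i y]. *)
Lemma lipschitz_with_sum_disjoint (n : nat) k (b : 'I_n -> M -> R) :
  0 <= k -> (forall i x, 0 <= b i x) -> (forall i, lipschitz_with k (b i)) ->
  (forall i j x, b i x != 0 -> b j x != 0 -> i = j) ->
  lipschitz_with k (fun x => \sum_(i < n) b i x).
Proof.
move=> k0 b0 bk disj; apply: lipschitz_with_sub => x y.
have by0 : 0 <= \sum_(i < n) b i y by apply: sumr_ge0.
have [/existsP[i bi]|/existsPn bx0] := boolP [exists i, b i x != 0].
  have -> : \sum_(j < n) b j x = b i x.
    rewrite (bigD1 i)//= big1 ?addr0// => j ji; apply/eqP/negPn/negP => bj.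
    by rewrite (disj _ _ _ bi bj) eqxx in ji.
  have : b i y <= \sum_(j < n) b j y.
    by rewrite (bigD1 i)//= lerDl sumr_ge0.
  by have := lipschitz_with_subr x y (bk i); lra.
rewrite big1 ?sub0r => [|i _]; last by apply/eqP/negPn.
by rewrite (@le_trans _ _ 0) ?oppr_le0// mulr_ge0// mdist_ge0.
Qed.

(** * Distance to the set of points of the sequence *)

Definition dist_pts (u : nat -> M) x : R :=
  inf [set mdist (u j) x | j in [set: nat]].

Section DistPts.
Variable u : nat -> M.

Lemma dist_pts_le j x : dist_pts u x <= mdist (u j) x.
Proof.
apply: ge_inf; last by exists j.
by exists 0 => _ [i _ <-]; exact: mdist_ge0.
Qed.

Lemma dist_pts_ge c x : (forall j, c <= mdist (u j) x) -> c <= dist_pts u x.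
Proof.
move=> cu; apply: lb_le_inf; first by exists (mdist (u 0%N) x), 0%N.
by move=> _ [j _ <-].
Qed.

Lemma dist_pts_self j : dist_pts u (u j) = 0.
Proof.
apply/eqP; rewrite eq_le dist_pts_ge ?andbT => [|i]; last exact: mdist_ge0.
by rewrite (le_trans (dist_pts_le j _))// mdistxx.
Qed.

Lemma lipschitz_with_dist_pts : lipschitz_with 1 (dist_pts u).
Proof.
apply: lipschitz_with_sub => x y; rewrite mul1r lerBlDr -lerBlDl.
apply: dist_pts_ge => j; have := dist_pts_le j x.
by have := metric_triangle (u j) y x; rewrite [mdist y x]metric_sym; lra.
Qed.

End DistPts.

(** * Raising a function near one point *)

Section Bump.
(** Used with [D = dist_pts u], [a = u i] and [v0 = u i.+1]; [v0] makes the infimum in the isolated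
    case one over a nonempty set. *)
Variables (D : M -> R) (a v0 : M).
Hypothesis v0a : v0 <> a.
Hypothesis Da : forall (delta : R) v, 0 < delta -> v <> a ->
  exists p, [/\ metric_segment a v delta p, p <> a &
    (1 - delta) * mdist a p < D p].

(* If [a] is isolated, raise [g] at [a] alone to the largest value [t] allowed
   by the Lipschitz condition; otherwise glue a small cone onto [g], using that
   the slack [eta] confines the cone to the ball of radius [r]. *)
Lemma bump g (eta r e : R) : 0 < eta -> 0 < r -> 0 < e ->
  lipschitz_with (1 - eta) g ->
  exists h, [/\ lipschitz_with 1 h, forall x, g x <= h x,
    forall x, r <= mdist a x -> h x = g x &
    exists p, [/\ p <> a, (1 - e) * mdist a p <= D p &
      (1 - e) * mdist a p <= h a - h p]].
Proof.
move=> eta0 r0 e0 geta.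
have g1 : lipschitz_with 1 g by apply: lipschitz_with_le geta; lra.
pose h t x := Num.max (g x) (t - mdist x a).
have h1 t : lipschitz_with 1 (h t) by exact: lipschitz_with_max_cone.
have gh t x : g x <= h t x by rewrite le_max lexx.
have ha (t : R) : t <= h t a by rewrite le_max mdistxx subr0 lexx orbT.
have hE t x : t - mdist x a <= g x -> h t x = g x by move=> /max_idPl.
have [[s s0 sa]|nisol] :=
    pselect (exists2 s : R, 0 < s & forall v, v <> a -> s <= mdist a v).
  (* [inf T] is the largest value at [a] that keeps the function 1-Lipschitz when [g] is left
     unchanged elsewhere. *)
  pose T := [set g v + mdist v a | v in [set v | v <> a]].
  have T0 : T !=set0 by exists (g v0 + mdist v0 a), v0.
  have Tlb : has_lbound T.
    exists (g a) => _ [v _ <-]; have := lipschitz_with_subr a v g1.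
    by rewrite mul1r metric_sym; lra.
  have hg v : v <> a -> h (inf T) v = g v.
    by move=> va; apply: hE; rewrite lerBlDr; apply: ge_inf => //; exists v.
  exists (h (inf T)); split=> // [x rx|].
    by apply: hg => xa; move: rx; rewrite xa mdistxx leNgt r0.
  (* Two errors of [e * s / 2], one from nearly attaining [inf T] at [v] and one from the segment,
     add up to at most [e * mdist a p], since [p <> a] is at distance at least [s]. *)
  have es0 : 0 < e * s / 2 by rewrite divr_gt0// mulr_gt0.
  have [_ [v va <-] vT] := inf_adherent es0 (conj T0 Tlb).
  have d0 : 0 < Num.min e (e * s / 2) by rewrite lt_min e0.
  have [p [seg pa Dp]] := Da d0 va; exists p; split => //.
    apply: le_trans (ltW Dp); rewrite ler_wpM2r ?mdist_ge0//.
    by rewrite lerD2l lerN2 ge_min lexx.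
  rewrite (hg _ pa); have := ha (inf T).
  have := lipschitz_with_subr p v g1; rewrite mul1r [mdist p v]metric_sym.
  have : Num.min e (e * s / 2) <= e * s / 2 by rewrite ge_min lexx orbT.
  have : e * s <= e * mdist a p by rewrite ler_pM2l// sa.
  by move: seg vT; rewrite /metric_segment/= [mdist v a]metric_sym; lra.
(* As [g] is [(1 - eta)]-Lipschitz, the cone of height [t] lies below [g] at distance [r] or more
   from [a]. *)
set t := g a + eta * r.
have er0 : 0 < eta * r by rewrite mulr_gt0.
exists (h t); split=> // [x rx|].
  apply: hE; have := lipschitz_with_subr a x geta.
  rewrite [mdist x a]metric_sym.
  have : eta * r <= eta * mdist a x by rewrite ler_pM2l.
  by rewrite /t; lra.
have [v va av] : exists2 v, v <> a & mdist a v < eta * r / 4.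
  apply: contrapT => nv; apply: nisol; exists (eta * r / 4); first by lra.
  by move=> v va; rewrite leNgt; apply/negP => av; apply: nv; exists v.
have d0 : 0 < Num.min e (eta * r / 4) by rewrite lt_min e0/=; lra.
have [p [seg pa Dp]] := Da d0 va; exists p; split => //.
  apply: le_trans (ltW Dp); rewrite ler_wpM2r ?mdist_ge0//.
  by rewrite lerD2l lerN2 ge_min lexx.
(* This close to [a] the cone lies above [g], so [h t] drops from [a] to [p] with slope at least
   1. *)
have ap : mdist a p < eta * r / 2.
  have : Num.min e (eta * r / 4) <= eta * r / 4 by rewrite ge_min lexx orbT.
  by move: seg; rewrite /metric_segment/=; have := mdist_ge0 v p; lra.
have -> : h t p = t - mdist a p.
  rewrite /h [mdist p a]metric_sym; apply/max_idPr.
  have := lipschitz_with_subr p a g1; rewrite mul1r [mdist p a]metric_sym /t.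
  by lra.
have : 0 <= e * mdist a p by rewrite mulr_ge0 ?mdist_ge0// ltW.
by have := ha t; lra.
Qed.

End Bump.

(** Makes the balls of radius [r] about the points disjoint, hence also the supports of the bumps.
    The seed 1 of the minimum covers the case without pairs. *)
Lemma separation_radius (n : nat) (u : 'I_n -> M) : injective u ->
  exists2 r : R, 0 < r & forall i j, i != j -> 2 * r <= mdist (u i) (u j).
Proof.
move=> uI; pose m : R := \big[Num.min/1]_(ij : 'I_n * 'I_n | ij.1 != ij.2)
  mdist (u ij.1) (u ij.2).
have m0 : 0 < m.
  apply: lt_bigmin => // -[i j] /= ij.
  by rewrite mdist_gt0 (inj_eq uI).
exists (m / 2); first by rewrite divr_gt0.
move=> i j ij; rewrite mulrCA divff ?mulr1//.
exact: (@bigmin_le_cond _ _ _ _ (i, j)).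
Qed.

End LipschitzFunctions.

(** Lets the constructions ignore the base point: slopes and norms depend only on increments. *)
Lemma lip0_recenter (R : realType) (M : metricType R) (o : M) k (h : M -> R) :
  lipschitz_with k h -> exists f : lip0 o, forall x, f x = h x - h o.
Proof.
move=> hk.
have hP : (fun x => h x - h o) \in lip0_pred o.
  rewrite inE; split; first by rewrite subrr.
  exists k => x y; rewrite opprB addrA subrK; exact: hk.
by exists (Lip0 hP).
Qed.

Lemma lip0_sumE (R : realType) (M : metricType R) (o : M) (I : finType)
    (F : I -> lip0 o) x :
  (\sum_i F i : lip0 o) x = \sum_i F i x.
Proof. exact: (big_morph (fun f : lip0 o => f x)). Qed.

(** * Averages, convex hulls and the unit ball *)

Section ConvexSets.
Context {R : realType} {X : completeNormedModType R}.

Lemma convex_set_average (A : set X) (n : nat) (x : 'I_n.+1 -> X) :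
  @convex_set R X A -> (forall i, A (x i)) ->
  A (n.+1%:R^-1 *: \sum_(i < n.+1) x i).
Proof.
move=> cA; elim: n x => [|n IH] x xA.
  by rewrite big_ord1 invr1 scale1r.
have l0 : 0 <= n.+1%:R / n.+2%:R :> R by rewrite divr_ge0.
have l1 : n.+1%:R / n.+2%:R <= 1 :> R by rewrite ler_pdivrMr// mul1r ler_nat.
have -> : n.+2%:R^-1 *: \sum_(i < n.+2) x i =
    n.+1%:R / n.+2%:R *:
      (n.+1%:R^-1 *: \sum_(i < n.+1) x (widen_ord (leqnSn _) i))
    + (1 - n.+1%:R / n.+2%:R) *: x ord_max.
  rewrite big_ord_recr/= scalerDr scalerA; congr (_ *: _ + _ *: _).
    by rewrite mulrAC divff ?mul1r.
  by rewrite -[X in X - _](@divff _ n.+2%:R)// -mulrBl -natrB// subSnn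
    mul1r.
apply/set_mem; apply: (cA _ _ (Itv01 l0 l1)); apply: mem_set => //.
exact: IH.
Qed.

Lemma convex_set_hull (A : set X) : @convex_set R X (convex_hull A).
Proof.
move=> x y l /set_mem xA /set_mem yA; apply: mem_set => B [cB AB].
by apply/set_mem/cB; apply: mem_set; [exact: xA|exact: yA].
Qed.

Lemma convex_set_unit_ball : @convex_set R X [set y | `|y| <= 1].
Proof.
move=> x y l; rewrite !inE/= => x1 y1.
rewrite (le_trans (ler_normD _ _))// !normrZ.
rewrite (@ger0_norm _ l%:num)// (@ger0_norm _ (1 - l%:num)) ?subr_ge0//.
by rewrite -[leRHS](subrKC l%:num) lerD// ler_piMr// subr_ge0.
Qed.

Lemma closed_unit_ball : closed [set y : X | `|y| <= 1].
Proof.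
have := @closed_closed_ball_ R X 0 1; congr closed.
by apply/seteqP; split=> y; rewrite /closed_ball_/= sub0r normrN.
Qed.

End ConvexSets.

(** * The Daugavet-point *)

Theorem proposition5p4 (R : realType) (M : metricType R) (o : M) (u : nat -> M) :
  injective u ->
  (forall (i : nat) (delta : R) (v : M), 0 < delta -> v <> u i ->
     exists p : M,
       [/\ metric_segment (u i) v delta p, p <> u i &
           inf [set mdist (u j) p | j in [set: nat]] >
             (1 - delta) * mdist (u i) p]) ->
  exists f : lip0 o, daugavet_point f.
Proof.
move=> uI Hu.
have [f fE] := lip0_recenter o (lipschitz_with_dist_pts u).
have u_neq i : u i.+1 <> u i by move=> /uI /eqP; rewrite eqn_leq ltnn.
have slope_norm (F : lip0 o) c i p : p <> u i ->
    c * mdist (u i) p <= F p - F (u i) -> c <= `|F|.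
  move=> pa cF; have dp : 0 < mdist (u i) p.
    by rewrite mdist_gt0 eq_sym; apply/eqP.
  rewrite -(ler_pM2r dp) (le_trans cF)// metric_sym.
  exact: le_trans (ler_norm _) (lip0_ler _ _ _).
exists f; split.
  apply/eqP; rewrite eq_le; apply/andP; split.
    apply: lip0_norm_le => // x y; rewrite !fE opprB addrA subrK.
    exact: lipschitz_with_dist_pts.
  apply/ler_addgt0Pr => e e0.
  have [p [_ pa Dp]] := Hu 0%N e (u 1%N) e0 (u_neq 0%N).
  rewrite -lerBlDr; apply: (slope_norm _ _ 0%N p) => //.
  by rewrite !fE opprB addrA subrK dist_pts_self subr0 ltW.
move=> e e0; apply/seteqP; split; last first.
  (* The easy inclusion: the unit ball is closed and convex. *)
  rewrite [X in _ `<=` X](iffLR (closure_id _)); last exact: closed_unit_ball.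
  apply: closureS; apply: smallest_sub; first exact: convex_set_unit_ball.
  by move=> y [].
move=> g /= g1 B /nbhs_ballP[s /= s0 sB].
(* Shrinking [g] by [1 - eta] gives [bump] its slack at a cost of at most [s / 4]; the bound [2^-1]
   keeps the factor nonnegative. Averaging will cost [2 / n.+1], also below [s / 4]. *)
pose eta := Num.min (s / 4) 2^-1.
have eta0 : 0 < eta by rewrite lt_min divr_gt0//= invr_gt0.
have etas : eta <= s / 4 by rewrite ge_min lexx.
have eta1 : eta <= 2^-1 by rewrite ge_min lexx orbT.
have [n ns] : exists n : nat, 2 / n.+1%:R < s / 4.
  have [n _ /(_ _ (leqnn _)) sn] :=
    near_infty_natSinv_lt (PosNum (divr_gt0 s0 (ltr0n _ 8))).
  by exists n; move: sn => /=; set w := _.+1%:R^-1; lra.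
have [r r0 ru] := @separation_radius _ _ n.+1 (u \o val)
  (inj_comp uI val_inj).
have eta1_ge0 : 0 <= 1 - eta by lra.
have glip : lipschitz_with (1 - eta) ((1 - eta) *: g : lip0 o).
  move=> x y; rewrite (le_trans (lip0_ler _ _ _))// ler_wpM2r ?mdist_ge0//.
  by rewrite normrZ ger0_norm// ler_piMr.
have e20 : 0 < e / 2 by rewrite divr_gt0.
have /choice[h hP] (i : 'I_n.+1) := bump (u_neq i) (Hu i) eta0 r0 e20 glip.
have /choice[H HE] (i : 'I_n.+1) : exists F : lip0 o,
    forall x, F x = h i x - h i o.
  by have [hi _ _ _] := hP i; exact: lip0_recenter hi.
exists (n.+1%:R^-1 *: \sum_(i < n.+1) H i); split.
  apply: convex_set_average => [|i].
    exact: convex_set_hull.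
  apply: sub_gen_smallest; have [h1 _ _ [p [pa Dp hp]]] := hP i; split => /=.
    apply: lip0_norm_le => // x y; rewrite !HE opprB addrA subrK; exact: h1.
  (* From [u i] to [p], [f] rises and [H i] falls, each with slope at least [1 - e / 2], so
     [f - H i] has slope at least [2 - e]. *)
  apply: (slope_norm _ _ i p) => //.
  rewrite /= !fctE !fE !HE dist_pts_self; move: Dp hp; rewrite /dist_pts; lra.
apply: sB; rewrite -ball_normE/=.
set g' := (1 - eta) *: g in glip hP.
have -> : g - n.+1%:R^-1 *: \sum_(i < n.+1) H i =
    eta *: g - n.+1%:R^-1 *: \sum_(i < n.+1) (H i - g').
  rewrite sumrB scalerBr opprB addrA sumr_const card_ord.
  rewrite -[g' *+ _]scaler_nat scalerA.
  by rewrite mulVf// scale1r /g' -scalerDl subrKC scale1r.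
(* Up to an additive constant [H i - g'] is the bump [h i - g'], which is 2-Lipschitz and vanishes
   outside the ball of radius [r] about [u i]. *)
have bumps : `|\sum_(i < n.+1) (H i - g')| <= 2.
  have lipS : lipschitz_with 2 (fun x => \sum_(i < n.+1) (h i x - g' x)).
    apply: lipschitz_with_sum_disjoint => // [i x|i|i j x].
    - by rewrite subr_ge0; have [_ ->] := hP i.
    - have [h1 _ _ _] := hP i.
      by apply: lipschitz_with_le (lipschitz_withB h1 glip); lra.
    - have near_u k : h k x - g' x != 0 -> mdist (u k) x < r.
        rewrite subr_eq0 ltNge => hk; apply/negP => rk.
        by have [_ _ /(_ _ rk) hkE _] := hP k; rewrite hkE eqxx in hk.
      move=> /near_u ix /near_u jx; apply/eqP/negPn/negP => /ru /=.
      have := metric_triangle (u i) x (u j).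
      by rewrite [mdist x (u j)]metric_sym; lra.
  apply: lip0_norm_le => // x y; have := lipS x y; congr (`|_| <= _).
  rewrite !lip0_sumE -!sumrB; apply: eq_bigr => i _.
  by rewrite /= !fctE !HE /GRing.scale/=; ring.
rewrite (le_lt_trans (ler_normB _ _))// !normrZ !ger0_norm ?(ltW eta0)//.
apply: (@le_lt_trans _ _ (eta + 2 / n.+1%:R)).
  by rewrite [2 / _]mulrC lerD// ?ler_wpM2l// ler_piMr// ltW.
by rewrite (lt_trans (ler_ltD etas ns))//; lra.
Qed.
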